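(* Let $G$ be an abelian group, $\mathbb F$ a field, and let $\varepsilon,\varepsilon'\colon G\times G\to\mathbb F$ be generic $G$-graded contractions. The lax monoidal functors $F_\varepsilon:=(\mathrm{Id},J^\varepsilon,\mathrm{id}_{\mathbb F})$ and $F_{\varepsilon'}:=(\mathrm{Id},J^{\varepsilon'},\mathrm{id}_{\mathbb F})$ from the monoidal category $\mathrm{Vec}^G$ to itself are naturally isomorphic (as lax monoidal functors) if and only if $\varepsilon$ and $\varepsilon'$ are equivalent via normalization, i.e., $\varepsilon'=\varepsilon\,d\alpha$ for some map $\alpha\colon G\to\mathbb F^\times$, where $d\alpha(g,h)=\alpha(g)\alpha(h)\alpha(gh)^{-1}$ for all $g,h\in G$.
   Context: $G$ is written multiplicatively with identity $e$. A generic $G$-graded contraction is a map $\varepsilon\colon G\times G\to\mathbb F$ with $\varepsilon(g,h)=\varepsilon(h,g)$ and $\varepsilon(g,hk)\varepsilon(h,k)=\varepsilon(k,gh)\varepsilon(g,h)$ for all $g,h,k\in G$. The product $\varepsilon\,d\alpha$ is the pointwise product of functions. $\mathrm{Vec}^G$ is the category of $G$-graded $\mathbb F$-vector spaces with degree-preserving linear maps. It is monoidal with tensor product $(V\otimes W)_g=\bigoplus_{xy=g}V_x\otimes W_y$, unit object $\mathsf 1$ given by $\mathsf 1_e=\mathbb F$ and $\mathsf 1_g=0$ for $g\ne e$, and the associativity and unit constraints of vector spaces. A lax monoidal functor from a monoidal category $\mathcal C$ (tensor product $\otimes$, unit object $\mathsf 1$, associator $a$, left and right unit constraints $l,r$)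 to a monoidal category $\mathcal C'$ (with $\otimes',\mathsf 1',a',l',r'$) is a triple $(F,J,\epsilon)$, where $F\colon\mathcal C\to\mathcal C'$ is a functor, $\epsilon\colon\mathsf 1'\to F(\mathsf 1)$ is a morphism, and $J_{X,Y}\colon F(X)\otimes'F(Y)\to F(X\otimes Y)$ is a natural transformation, such that for all objects $X,Y,Z$: (associativity) $F(a_{X,Y,Z})\circ J_{X\otimes Y,Z}\circ(J_{X,Y}\otimes'\mathrm{id})=J_{X,Y\otimes Z}\circ(\mathrm{id}\otimes'J_{Y,Z})\circ a'_{F(X),F(Y),F(Z)}$; (unitality) $F(l_X)\circ J_{\mathsf 1,X}\circ(\epsilon\otimes'\mathrm{id})=l'_{F(X)}$ and $F(r_X)\circ J_{X,\mathsf 1}\circ(\mathrm{id}\otimes'\epsilon)=r'_{F(X)}$. A monoidal natural transformation from $(F,J,\epsilon)$ to $(H,I,\kappa)$ is a natural transformation $\nu\colon F\to H$ such that $\nu_{X\otimes Y}\circ J_{X,Y}=I_{X,Y}\circ(\nu_X\otimes'\nu_Y)$ for all $X,Y$, and $\nu_{\mathsf 1}\circ\epsilon=\kappa$. Two lax monoidal functors are naturally isomorphic if there is a monoidal natural transformation between them that is a natural isomorphism. In $F_\varepsilon=(\mathrm{Id},J^\varepsilon,\mathrm{id}_{\mathbb F})$, $\mathrm{Id}$ is the identity endofunctor of $\mathrm{Vec}^G$, the unit morphism $\epsilon\colon\mathsf 1\to\mathsf 1$ is the identity $\mathrm{id}_{\mathbb F}$, and $J^\varepsilon_{V,W}\colon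 V\otimes W\to V\otimes W$ is given by $J^\varepsilon_{V,W}(v\otimes w)=\varepsilon(g,h)\,v\otimes w$ for $v\in V_g$, $w\in W_h$, $g,h\in G$.
   Formalization: It is assumed in addition that F_ε and F_ε' really are lax monoidal functors (equivalently ε(e,g)=ε'(e,g)=1 for all g), which does not hold for every generic graded contraction; without it the claim fails, e.g. G trivial, ε=1, ε'=2. *)

(* Defs.v *)
From HB Require Import structures.
From mathcomp Require Import all_boot all_algebra.
From mathcomp Require Import boolp.

Set Implicit Arguments.
Unset Strict Implicit.
Unset Printing Implicit Defensive.

Import GRing.Theory.
Local Open Scope ring_scope.
Local Open Scope quotient_scope.

Section LinearMaps.
Variables (F : fieldType) (U V : lmodType F) (f : U -> V).
Hypothesis f_lin : linear f.

Lemma linearD_of u v : f (u + v) = f u + f v.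
Proof. by have := f_lin 1 u v; rewrite !scale1r. Qed.

Lemma linear0_of : f 0 = 0.
Proof. by apply: (@addrI _ (f 0)); rewrite -linearD_of !addr0. Qed.

Lemma linearZ_of a u : f (a *: u) = a *: f u.
Proof. by have := f_lin a u 0; rewrite linear0_of !addr0. Qed.

Lemma linear_sum_of I (s : seq I) (c : I -> U) :
  f (\sum_(i <- s) c i) = \sum_(i <- s) f (c i).
Proof.
elim: s => [|i s IH]; first by rewrite !big_nil linear0_of.
by rewrite !big_cons linearD_of IH.
Qed.

End LinearMaps.

Section LinearClosure.
Variables (F : fieldType) (U V W : lmodType F).

Lemma linear_id : linear (@id U). Proof. by []. Qed.

Lemma linear_comp (g : V -> W) (f : U -> V) :
  linear g -> linear f -> linear (g \o f).
Proof. by move=> hg hf a u v /=; rewrite hf hg. Qed.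

Lemma linear_scaler (c : F) (f : U -> V) : linear f -> linear (fun u => c *: f u).
Proof. by move=> hf a u v; rewrite hf scalerDr !scalerA mulrC. Qed.

Lemma linear_sumf I (s : seq I) (f : I -> U -> V) :
  (forall i, linear (f i)) -> linear (fun u => \sum_(i <- s) f i u).
Proof.
move=> hf a u v; rewrite scaler_sumr -big_split /=.
by apply: eq_bigr => i _; rewrite hf.
Qed.

End LinearClosure.

Section TensorProduct.
Variables (F : fieldType) (V W : lmodType F).
Implicit Types (s t : seq (V * W)).

(* A list [:: (v1, w1); ...; (vn, wn)] stands for v1 (x) w1 + ... + vn (x) wn. *)
Inductive tens_rel : seq (V * W) -> seq (V * W) -> Prop :=
| tens_refl s : tens_rel s s
| tens_sym s t : tens_rel s t -> tens_rel t s
| tens_trans s t u : tens_rel s t -> tens_rel t u -> tens_rel s u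
| tens_cat s s' t t' :
    tens_rel s s' -> tens_rel t t' -> tens_rel (s ++ t) (s' ++ t')
| tens_catC s t : tens_rel (s ++ t) (t ++ s)
| tens_zerol w : tens_rel [:: (0, w)] [::]
| tens_addl v v' w : tens_rel [:: (v + v', w)] [:: (v, w); (v', w)]
| tens_addr v w w' : tens_rel [:: (v, w + w')] [:: (v, w); (v, w')]
| tens_scale (a : F) v w : tens_rel [:: (a *: v, w)] [:: (v, a *: w)].

Definition tens_relb s t : bool := `[< tens_rel s t >].

Lemma tens_relb_refl : reflexive tens_relb.
Proof. by move=> s; apply/asboolP; exact: tens_refl. Qed.

Lemma tens_relb_sym : symmetric tens_relb.
Proof.
by move=> s t; apply/asboolP/asboolP => h; exact: tens_sym.
Qed.

Lemma tens_relb_trans : transitive tens_relb.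
Proof.
move=> t s u /asboolP st /asboolP tu; apply/asboolP; exact: tens_trans tu.
Qed.

Canonical tens_equiv :=
  EquivRel tens_relb tens_relb_refl tens_relb_sym tens_relb_trans.

Definition tens := {eq_quot tens_equiv}.
HB.instance Definition _ : EqQuotient _ tens_equiv tens := EqQuotient.on tens.
HB.instance Definition _ := Choice.on tens.

Definition tens_class s : tens := \pi_tens s.

Lemma tens_classP s t : tens_rel s t -> tens_class s = tens_class t.
Proof. by move=> st; apply/eqmodP/asboolP. Qed.

Lemma tens_repr s : tens_rel (repr (tens_class s)) s.
Proof.
have /eqmodP/asboolP : \pi_tens (repr (tens_class s)) = \pi_tens s by rewrite reprK.
by [].
Qed.

Lemma tens_reprK (t : tens) : tens_class (repr t) = t.
Proof. exact: reprK. Qed.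

Definition tens_add (x y : tens) : tens := tens_class (repr x ++ repr y).
Definition tens_scaling (a : F) (x : tens) : tens :=
  tens_class [seq (a *: p.1, p.2) | p <- repr x].

Lemma tens_addE s t : tens_add (tens_class s) (tens_class t) = tens_class (s ++ t).
Proof. by apply: tens_classP; apply: tens_cat; exact: tens_repr. Qed.

Lemma tens_rel_scale a s t : tens_rel s t ->
  tens_rel [seq (a *: p.1, p.2) | p <- s] [seq (a *: p.1, p.2) | p <- t].
Proof.
elim=> {s t} /=.
- by move=> s; exact: tens_refl.
- by move=> s t _; exact: tens_sym.
- by move=> s t u _ h _; exact: tens_trans.
- by move=> s s' t t' _ h _ h'; rewrite !map_cat; exact: tens_cat.
- by move=> s t; rewrite !map_cat; exact: tens_catC.
- by move=> w; rewrite scaler0; exact: tens_zerol.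
- by move=> v v' w; rewrite scalerDr; exact: tens_addl.
- by move=> v w w'; exact: tens_addr.
- by move=> b v w; rewrite scalerA mulrC -scalerA; exact: tens_scale.
Qed.

Lemma tens_scalingE a s :
  tens_scaling a (tens_class s) = tens_class [seq (a *: p.1, p.2) | p <- s].
Proof. by apply: tens_classP; apply: tens_rel_scale; exact: tens_repr. Qed.

Fact tens_addA : associative tens_add.
Proof.
move=> x y z; rewrite -[x]tens_reprK -[y]tens_reprK -[z]tens_reprK.
by rewrite !tens_addE catA.
Qed.

Fact tens_addC : commutative tens_add.
Proof. by move=> x y; apply: tens_classP; exact: tens_catC. Qed.

Fact tens_add0 : left_id (tens_class [::]) tens_add.
Proof. by move=> x; rewrite -[x]tens_reprK tens_addE. Qed.

HB.instance Definition _ := GRing.isNmodule.Build tens tens_addA tens_addC tens_add0.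

Definition pure v w : tens := tens_class [:: (v, w)].

Lemma tens_class_cat s t : tens_class (s ++ t) = tens_class s + tens_class t.
Proof. by rewrite -tens_addE. Qed.

Lemma tens_class_sum s : tens_class s = \sum_(p <- s) pure p.1 p.2.
Proof.
elim: s => [|[v w] s IH]; first by rewrite big_nil.
by rewrite big_cons -IH -cat1s tens_class_cat.
Qed.

Lemma pureDl v v' w : pure (v + v') w = pure v w + pure v' w.
Proof. by rewrite -tens_class_cat; apply: tens_classP; exact: tens_addl. Qed.

Lemma pure0l w : pure 0 w = 0.
Proof. exact/tens_classP/tens_zerol. Qed.

Lemma tens_scalingD a : {morph tens_scaling a : x y / x + y}.
Proof.
move=> x y; rewrite -[x]tens_reprK -[y]tens_reprK.
by rewrite -tens_class_cat !tens_scalingE map_cat tens_class_cat.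
Qed.

Lemma tens_scaling_pure a v w : tens_scaling a (pure v w) = pure (a *: v) w.
Proof. exact: tens_scalingE. Qed.

Lemma tens_scaling_sum a s :
  tens_scaling a (\sum_(p <- s) pure p.1 p.2) = \sum_(p <- s) pure (a *: p.1) p.2.
Proof.
by rewrite -tens_class_sum tens_scalingE tens_class_sum big_map.
Qed.

Lemma tens_sumP (t : tens) : exists s, t = \sum_(p <- s) pure p.1 p.2.
Proof. by exists (repr t); rewrite -tens_class_sum tens_reprK. Qed.

Fact tens_addN : left_inverse 0 (tens_scaling (-1)) +%R.
Proof.
move=> x; have [s ->] := tens_sumP x.
rewrite tens_scaling_sum -big_split big1_seq //= => p _.
by rewrite -pureDl scaleN1r addNr pure0l.
Qed.

HB.instance Definition _ := GRing.Nmodule_isZmodule.Build tens tens_addN.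

Fact tens_scalingA a b x : tens_scaling a (tens_scaling b x) = tens_scaling (a * b) x.
Proof.
rewrite -[x]tens_reprK !tens_scalingE -map_comp; congr tens_class.
by apply: eq_map => p /=; rewrite scalerA.
Qed.

Fact tens_scaling1 : left_id 1 tens_scaling.
Proof.
move=> x; rewrite -[x]tens_reprK !tens_scalingE; congr tens_class.
by rewrite -[RHS]map_id; apply: eq_map => -[v w] /=; rewrite scale1r.
Qed.

Fact tens_scalingDr : right_distributive tens_scaling +%R.
Proof. by move=> a; exact: tens_scalingD. Qed.

Fact tens_scalingDl x : {morph tens_scaling^~ x : a b / a + b}.
Proof.
move=> a b; have [s ->] := tens_sumP x.
rewrite !tens_scaling_sum -big_split; apply: eq_bigr => p _.
by rewrite scalerDl pureDl.
Qed.

HB.instance Definition _ := GRing.Zmodule_isLmodule.Build F tens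
  tens_scalingA tens_scaling1 tens_scalingDr tens_scalingDl.

Lemma pureZl a v w : pure (a *: v) w = a *: pure v w.
Proof. by rewrite -tens_scaling_pure. Qed.

Lemma pureZr a v w : pure v (a *: w) = a *: pure v w.
Proof. by rewrite -pureZl; apply/esym/tens_classP; exact: tens_scale. Qed.

Lemma pureDr v w w' : pure v (w + w') = pure v w + pure v w'.
Proof. by rewrite -tens_class_cat; apply: tens_classP; exact: tens_addr. Qed.

End TensorProduct.

Definition bilinear_map (F : fieldType) (V W U : lmodType F) (b : V -> W -> U) : Prop :=
  (forall w, linear (b^~ w)) /\ (forall v, linear (b v)).

Section TensorUniversal.
Variables (F : fieldType) (V W U : lmodType F).

Lemma pure_bilinear : bilinear_map (@pure F V W).
Proof.
by split=> [w a v v'|v a w w']; rewrite ?pureDl ?pureDr ?pureZl ?pureZr.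
Qed.

Definition tens_lift (b : V -> W -> U) (t : tens V W) : U :=
  \sum_(p <- repr t) b p.1 p.2.

Lemma tens_lift_class (b : V -> W -> U) s : bilinear_map b ->
  tens_lift b (tens_class s) = \sum_(p <- s) b p.1 p.2.
Proof.
case=> bl br; rewrite /tens_lift.
have rel_sum t u : tens_rel t u -> \sum_(p <- t) b p.1 p.2 = \sum_(p <- u) b p.1 p.2.
  2: exact/rel_sum/tens_repr.
elim=> {t u} //=.
- by move=> ? ? ? _ -> _ ->.
- by move=> ? ? ? ? _ h _ h'; rewrite !big_cat /= h h'.
- by move=> ? ?; rewrite !big_cat /= addrC.
- by move=> w; rewrite big_cons big_nil /= addr0 (linear0_of (bl w)).
- by move=> v v' w; rewrite !big_cons !big_nil /= !addr0 (linearD_of (bl w)).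
- by move=> v w w'; rewrite !big_cons !big_nil /= !addr0 (linearD_of (br v)).
- by move=> a v w; rewrite !big_cons !big_nil /= (linearZ_of (bl w)) (linearZ_of (br v)).
Qed.

Lemma tens_liftE (b : V -> W -> U) v w : bilinear_map b -> tens_lift b (pure v w) = b v w.
Proof. by move=> hb; rewrite tens_lift_class // big_seq1. Qed.

Lemma tens_lift_linear (b : V -> W -> U) : bilinear_map b -> linear (tens_lift b).
Proof.
move=> hb a x y; rewrite -[x]tens_reprK -[y]tens_reprK.
have -> : a *: tens_class (repr x) = tens_class [seq (a *: p.1, p.2) | p <- repr x].
  exact: tens_scalingE.
rewrite -tens_class_cat !tens_lift_class // big_cat big_map /= scaler_sumr.
by congr (_ + _); apply: eq_bigr => p _; rewrite (linearZ_of (hb.1 _)).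
Qed.

Lemma tens_ext (f g : tens V W -> U) : linear f -> linear g ->
  (forall v w, f (pure v w) = g (pure v w)) -> f =1 g.
Proof.
move=> hf hg fg t; have [s ->] := tens_sumP t.
by rewrite !linear_sum_of //; apply: eq_bigr.
Qed.

End TensorUniversal.

Section TensorMaps.
Variable F : fieldType.
Implicit Types V W U T S : lmodType F.

Definition tens_map V V' W W' (f : V -> V') (g : W -> W') : tens V W -> tens V' W' :=
  tens_lift (fun v w => pure (f v) (g w)).

Lemma tens_map_bilinear V V' W W' (f : V -> V') (g : W -> W') :
  linear f -> linear g -> bilinear_map (fun v w => pure (f v) (g w)).
Proof.
move=> hf hg; have [pl pr] := @pure_bilinear F V' W'.
split=> [w|v]; first exact: (linear_comp (pl (g w)) hf).
exact: (linear_comp (pr (f v)) hg).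
Qed.

Lemma tens_map_linear V V' W W' (f : V -> V') (g : W -> W') :
  linear f -> linear g -> linear (tens_map f g).
Proof. by move=> hf hg; exact/tens_lift_linear/tens_map_bilinear. Qed.

Lemma tens_mapE V V' W W' (f : V -> V') (g : W -> W') v w :
  linear f -> linear g -> tens_map f g (pure v w) = pure (f v) (g w).
Proof. by move=> hf hg; rewrite /tens_map tens_liftE //; exact: tens_map_bilinear. Qed.

Definition tens_assoc V W U : tens (tens V W) U -> tens V (tens W U) :=
  tens_lift (fun t u => tens_lift (fun v w => pure v (pure w u)) t).

Definition tens_assoc_inv V W U : tens V (tens W U) -> tens (tens V W) U :=
  tens_lift (fun v t => tens_lift (fun w u => pure (pure v w) u) t).

Lemma pure3_bilinear V W U (u : U) :
  bilinear_map (fun (v : V) (w : W) => pure v (pure w u)).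
Proof.
split=> [w|v]; first exact: (@pure_bilinear F V (tens W U)).1.
exact: (linear_comp ((@pure_bilinear F V (tens W U)).2 v) ((@pure_bilinear F W U).1 u)).
Qed.

Lemma tens_assoc_bilinear V W U : bilinear_map (fun (t : tens V W) (u : U) =>
  tens_lift (fun v w => pure v (pure w u)) t).
Proof.
split=> [u|t]; first exact/tens_lift_linear/pure3_bilinear.
apply: linear_sumf => -[v w] /=.
exact: (linear_comp ((@pure_bilinear F V (tens W U)).2 v) ((@pure_bilinear F W U).2 w)).
Qed.

Lemma tens_assoc_linear V W U : linear (@tens_assoc V W U).
Proof. exact/tens_lift_linear/tens_assoc_bilinear. Qed.

Lemma tens_assocE V W U (v : V) (w : W) (u : U) :
  tens_assoc (pure (pure v w) u) = pure v (pure w u).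
Proof.
rewrite /tens_assoc tens_liftE; last exact: tens_assoc_bilinear.
by rewrite tens_liftE //; exact: pure3_bilinear.
Qed.

Lemma pure3_inv_bilinear V W U (v : V) :
  bilinear_map (fun (w : W) (u : U) => pure (pure v w) u).
Proof.
split=> [u|w]; last exact: (@pure_bilinear F (tens V W) U).2.
exact: (linear_comp ((@pure_bilinear F (tens V W) U).1 u) ((@pure_bilinear F V W).2 v)).
Qed.

Lemma tens_assoc_inv_bilinear V W U : bilinear_map (fun (v : V) (t : tens W U) =>
  tens_lift (fun w u => pure (pure v w) u) t).
Proof.
split=> [t|v]; last exact/tens_lift_linear/pure3_inv_bilinear.
apply: linear_sumf => -[w u] /=.
exact: (linear_comp ((@pure_bilinear F (tens V W) U).1 u) ((@pure_bilinear F V W).1 w)).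
Qed.

Lemma tens_assoc_inv_linear V W U : linear (@tens_assoc_inv V W U).
Proof. exact/tens_lift_linear/tens_assoc_inv_bilinear. Qed.

Lemma tens_assoc_invE V W U (v : V) (w : W) (u : U) :
  tens_assoc_inv (pure v (pure w u)) = pure (pure v w) u.
Proof.
rewrite /tens_assoc_inv tens_liftE; last exact: tens_assoc_inv_bilinear.
by rewrite tens_liftE //; exact: pure3_inv_bilinear.
Qed.

Definition tens_lunit V : tens F^o V -> V := tens_lift (fun (k : F^o) v => (k : F) *: v).
Definition tens_runit V : tens V F^o -> V := tens_lift (fun v (k : F^o) => (k : F) *: v).

Lemma tens_lunit_bilinear V : bilinear_map (fun (k : F^o) (v : V) => (k : F) *: v).
Proof.
split=> [v a k k'|k a v v'].
  by rewrite scalerDl scalerA.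
by rewrite scalerDr !scalerA mulrC.
Qed.

Lemma tens_runit_bilinear V : bilinear_map (fun (v : V) (k : F^o) => (k : F) *: v).
Proof. by have [hl hr] := tens_lunit_bilinear V; split. Qed.

Lemma tens_lunit_linear V : linear (@tens_lunit V).
Proof. exact/tens_lift_linear/tens_lunit_bilinear. Qed.

Lemma tens_runit_linear V : linear (@tens_runit V).
Proof. exact/tens_lift_linear/tens_runit_bilinear. Qed.

Lemma tens_lunitE V (k : F^o) (v : V) : tens_lunit (pure k v) = (k : F) *: v.
Proof. by rewrite /tens_lunit tens_liftE //; exact: tens_lunit_bilinear. Qed.

Lemma tens_runitE V (k : F^o) (v : V) : tens_runit (pure v k) = (k : F) *: v.
Proof. by rewrite /tens_runit tens_liftE //; exact: tens_runit_bilinear. Qed.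

Lemma tens_ext3l V W U T (f g : tens (tens V W) U -> T) : linear f -> linear g ->
  (forall v w u, f (pure (pure v w) u) = g (pure (pure v w) u)) -> f =1 g.
Proof.
move=> hf hg fg; apply: tens_ext => // t u; move: t.
apply: (@tens_ext _ _ _ _ (f \o (@pure F _ _)^~ u) (g \o (@pure F _ _)^~ u)) => [||v w].
- exact: (linear_comp hf ((@pure_bilinear F _ _).1 u)).
- exact: (linear_comp hg ((@pure_bilinear F _ _).1 u)).
- exact: fg.
Qed.

Lemma tens_ext3r V W U T (f g : tens V (tens W U) -> T) : linear f -> linear g ->
  (forall v w u, f (pure v (pure w u)) = g (pure v (pure w u))) -> f =1 g.
Proof.
move=> hf hg fg; apply: tens_ext => // v.
apply: (@tens_ext _ _ _ _ (f \o pure v) (g \o pure v)) => [||w u].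
- exact: (linear_comp hf ((@pure_bilinear F _ _).2 v)).
- exact: (linear_comp hg ((@pure_bilinear F _ _).2 v)).
- exact: fg.
Qed.

Lemma tens_ext4 V W U T S (f g : tens (tens (tens V W) U) T -> S) :
  linear f -> linear g ->
  (forall v w u t, f (pure (pure (pure v w) u) t) = g (pure (pure (pure v w) u) t)) ->
  f =1 g.
Proof.
move=> hf hg fg; apply: tens_ext => // x t; move: x.
apply: (@tens_ext3l _ _ _ _ (f \o (@pure F _ _)^~ t) (g \o (@pure F _ _)^~ t)) => [||v w u].
- exact: (linear_comp hf ((@pure_bilinear F _ _).1 t)).
- exact: (linear_comp hg ((@pure_bilinear F _ _).1 t)).
- exact: fg.
Qed.

End TensorMaps.


Declare Scope category_scope.

Record category := Category {
  obj :> Type;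
  hom : obj -> obj -> Type;
  idm : forall X, hom X X;
  comp : forall X Y Z, hom Y Z -> hom X Y -> hom X Z;
  comp_assoc : forall X Y Z T (h : hom Z T) (g : hom Y Z) (f : hom X Y),
    comp h (comp g f) = comp (comp h g) f;
  comp_idl : forall X Y (f : hom X Y), comp (idm Y) f = f;
  comp_idr : forall X Y (f : hom X Y), comp f (idm X) = f
}.

Arguments hom {c} X Y.
Arguments idm {c} X.
Arguments comp {c X Y Z} g f.
Notation "g '∘' f" := (comp g f) (at level 40, left associativity) : category_scope.
Local Open Scope category_scope.

Definition is_iso (C : category) (X Y : C) (f : hom X Y) : Prop :=
  exists g : hom Y X, g ∘ f = idm X /\ f ∘ g = idm Y.

Record functor (C D : category) := Functor {
  fobj :> C -> D;
  fmap : forall X Y, hom X Y -> hom (fobj X) (fobj Y);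
  fmap_id : forall X, fmap (idm X) = idm (fobj X);
  fmap_comp : forall X Y Z (g : hom Y Z) (f : hom X Y),
    fmap (g ∘ f) = fmap g ∘ fmap f
}.

Arguments fmap {C D} _ {X Y} _.

Definition id_functor (C : category) : functor C C :=
  @Functor C C id (fun X Y f => f) (fun X => erefl) (fun X Y Z g f => erefl).

Record monoidal_category := MonoidalCategory {
  mcat :> category;
  mtens : mcat -> mcat -> mcat;
  mtensh : forall X X' Y Y' : mcat,
    hom X X' -> hom Y Y' -> hom (mtens X Y) (mtens X' Y');
  munit : mcat;
  massoc : forall X Y Z : mcat, hom (mtens (mtens X Y) Z) (mtens X (mtens Y Z));
  mlunit : forall X : mcat, hom (mtens munit X) X;
  mrunit : forall X : mcat, hom (mtens X munit) X;
  mtensh_id : forall X Y : mcat, mtensh (idm X) (idm Y) = idm (mtens X Y);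
  mtensh_comp : forall (X X' X'' Y Y' Y'' : mcat)
    (f' : hom X' X'') (f : hom X X') (g' : hom Y' Y'') (g : hom Y Y'),
    mtensh (f' ∘ f) (g' ∘ g) = mtensh f' g' ∘ mtensh f g;
  massoc_nat : forall (X X' Y Y' Z Z' : mcat)
    (f : hom X X') (g : hom Y Y') (h : hom Z Z'),
    massoc X' Y' Z' ∘ mtensh (mtensh f g) h = mtensh f (mtensh g h) ∘ massoc X Y Z;
  mlunit_nat : forall (X X' : mcat) (f : hom X X'),
    mlunit X' ∘ mtensh (idm munit) f = f ∘ mlunit X;
  mrunit_nat : forall (X X' : mcat) (f : hom X X'),
    mrunit X' ∘ mtensh f (idm munit) = f ∘ mrunit X;
  massoc_iso : forall X Y Z : mcat, is_iso (massoc X Y Z);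
  mlunit_iso : forall X : mcat, is_iso (mlunit X);
  mrunit_iso : forall X : mcat, is_iso (mrunit X);
  mpentagon : forall X Y Z T : mcat,
    massoc X Y (mtens Z T) ∘ massoc (mtens X Y) Z T =
    mtensh (idm X) (massoc Y Z T) ∘ massoc X (mtens Y Z) T
      ∘ mtensh (massoc X Y Z) (idm T);
  mtriangle : forall X Y : mcat,
    mtensh (idm X) (mlunit Y) ∘ massoc X munit Y = mtensh (mrunit X) (idm Y)
}.

Arguments mtens {m} X Y.
Arguments mtensh {m X X' Y Y'} f g.
Arguments munit {m}.
Arguments massoc {m} X Y Z.
Arguments mlunit {m} X.
Arguments mrunit {m} X.
Notation "X ⊗ Y" := (mtens X Y) (at level 39, left associativity) : category_scope.
Notation "f ⊠ g" := (mtensh f g) (at level 39, left associativity) : category_scope.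

(* The data (F, J, epsilon) only; the axioms are [is_lax_monoidal]. *)
Record monoidal_triple (C D : monoidal_category) := MonoidalTriple {
  mt_functor :> functor C D;
  mt_mul : forall X Y : C, hom (mt_functor X ⊗ mt_functor Y) (mt_functor (X ⊗ Y));
  mt_unit : hom munit (mt_functor munit)
}.

Arguments mt_mul {C D} m X Y.
Arguments mt_unit {C D} m.

Record is_lax_monoidal (C D : monoidal_category) (T : monoidal_triple C D) : Prop := {
  lax_natural : forall (X X' Y Y' : C) (f : hom X X') (g : hom Y Y'),
    mt_mul T X' Y' ∘ (fmap T f ⊠ fmap T g) = fmap T (f ⊠ g) ∘ mt_mul T X Y;
  lax_assoc : forall X Y Z : C,
    fmap T (massoc X Y Z) ∘ mt_mul T (X ⊗ Y) Z ∘ (mt_mul T X Y ⊠ idm (T Z)) =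
    mt_mul T X (Y ⊗ Z) ∘ (idm (T X) ⊠ mt_mul T Y Z) ∘ massoc (T X) (T Y) (T Z);
  lax_unitl : forall X : C,
    fmap T (mlunit X) ∘ mt_mul T munit X ∘ (mt_unit T ⊠ idm (T X)) = mlunit (T X);
  lax_unitr : forall X : C,
    fmap T (mrunit X) ∘ mt_mul T X munit ∘ (idm (T X) ⊠ mt_unit T) = mrunit (T X)
}.

Record is_monoidal_natural (C D : monoidal_category) (T S : monoidal_triple C D)
    (nu : forall X : C, hom (T X) (S X)) : Prop := {
  mnat_natural : forall (X Y : C) (f : hom X Y), nu Y ∘ fmap T f = fmap S f ∘ nu X;
  mnat_mul : forall X Y : C,
    nu (X ⊗ Y) ∘ mt_mul T X Y = mt_mul S X Y ∘ (nu X ⊠ nu Y);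
  mnat_unit : nu munit ∘ mt_unit T = mt_unit S
}.

Definition monoidally_isomorphic (C D : monoidal_category)
    (T S : monoidal_triple C D) : Prop :=
  exists nu : forall X : C, hom (T X) (S X),
    is_monoidal_natural nu /\ forall X : C, is_iso (nu X).

Section GradedSpaces.
Variables (G : groupType) (F : fieldType).

(* A vector space with subspaces V_g (g in G) of which it is the internal
   direct sum. *)
Record graded_space := GradedSpace {
  gcarrier :> lmodType F;
  homog : G -> gcarrier -> Prop;
  homog0 : forall g, homog g 0;
  homogD : forall g v w, homog g v -> homog g w -> homog g (v + w);
  homogZ : forall g a v, homog g v -> homog g (a *: v);
  homog_span : forall v : gcarrier, exists s : seq (G * gcarrier),
    (forall p, p \in s -> homog p.1 p.2) /\ v = \sum_(p <- s) p.2;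
  homog_indep : forall (s : seq G) (c : G -> gcarrier), uniq s ->
    (forall g, homog g (c g)) -> \sum_(g <- s) c g = 0 ->
    forall g, g \in s -> c g = 0
}.

Arguments homog {_} _ _.

Record graded_hom (V W : graded_space) := GradedHom {
  ghom :> V -> W;
  ghom_linear : linear ghom;
  ghom_homog : forall g v, homog g v -> homog g (ghom v)
}.

Lemma graded_hom_eq (V W : graded_space) (f g : graded_hom V W) : f =1 g -> f = g.
Proof.
case: f g => [f fl fh] [g gl gh] /= /funext fg.
by case: _ / fg in gl gh *; congr GradedHom; exact: Prop_irrelevance.
Qed.

Definition graded_id (V : graded_space) : graded_hom V V :=
  @GradedHom V V id (@linear_id F V) (fun g v hv => hv).

Definition graded_comp (V W U : graded_space) (g : graded_hom W U)
    (f : graded_hom V W) : graded_hom V U :=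
  @GradedHom V U (g \o f) (linear_comp (ghom_linear g) (ghom_linear f))
    (fun x v hv => ghom_homog g (ghom_homog f hv)).

Fact graded_compA (V W U T : graded_space) (h : graded_hom U T)
    (g : graded_hom W U) (f : graded_hom V W) :
  graded_comp h (graded_comp g f) = graded_comp (graded_comp h g) f.
Proof. exact: graded_hom_eq. Qed.

Fact graded_compIl (V W : graded_space) (f : graded_hom V W) :
  graded_comp (graded_id W) f = f.
Proof. exact: graded_hom_eq. Qed.

Fact graded_compIr (V W : graded_space) (f : graded_hom V W) :
  graded_comp f (graded_id V) = f.
Proof. exact: graded_hom_eq. Qed.

Definition VecG_category : category :=
  Category graded_compA graded_compIl graded_compIr.

Section Components.
Variable V : graded_space.
Implicit Types (v w : V) (s : seq G) (c : G -> V).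

Lemma homog_sum g I (s : seq I) (f : I -> V) :
  (forall i, homog g (f i)) -> homog g (\sum_(i <- s) f i).
Proof.
move=> hf; elim: s => [|i s IH]; first by rewrite big_nil; exact: homog0.
by rewrite big_cons; apply: homogD.
Qed.

Definition decomposes v s c : Prop :=
  [/\ uniq s, forall g, homog g (c g), forall g, g \notin s -> c g = 0
    & v = \sum_(g <- s) c g].

Lemma decomposition v : exists p : seq G * (G -> V), decomposes v p.1 p.2.
Proof.
have [s [hs ->]] := homog_span v.
exists (undup [seq p.1 | p <- s], fun g => \sum_(p <- s | p.1 == g) p.2); split=> /=.
- exact: undup_uniq.
- move=> g; rewrite big_seq_cond; apply: big_ind => [|t u|p /andP[/hs hp /eqP <-]] //.
    exact: homog0.
  exact: homogD.
- move=> g; rewrite mem_undup => gs; rewrite big1_seq // => p /andP[/eqP pg ps].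
  by rewrite -pg map_f in gs.
- rewrite (exchange_big_dep predT) //= big_seq [RHS]big_seq; apply: eq_bigr => p ps.
  rewrite big_mkcond (bigD1_seq p.1) ?undup_uniq ?mem_undup ?map_f //= eqxx.
  by rewrite big1 ?addr0 // => g; rewrite eq_sym => /negPf->.
Qed.

Definition gsupp v : seq G := (projT1 (cid (decomposition v))).1.
Definition gcomp v : G -> V := (projT1 (cid (decomposition v))).2.

Lemma gcompP v : decomposes v (gsupp v) (gcomp v).
Proof. by rewrite /gsupp /gcomp; case: cid. Qed.

Lemma sum_support (U : lmodType F) (s t : seq G) (f : G -> U) :
  uniq s -> uniq t -> {subset s <= t} -> (forall g, g \notin s -> f g = 0) ->
  \sum_(g <- s) f g = \sum_(g <- t) f g.
Proof.
move=> us ut st f0; rewrite -[RHS](@big_rmcond_in _ _ _ _ _ (mem s)).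
  rewrite -[RHS]big_filter; apply: perm_big; apply: uniq_perm => //.
    exact: filter_uniq.
  by move=> g; rewrite mem_filter /= andb_idr // => /st.
by move=> g _; exact: f0.
Qed.

Lemma decomposes_uniq v s c t d : decomposes v s c -> decomposes v t d -> c =1 d.
Proof.
move=> [us hc c0 vE] [ut hd d0 vE'] g; pose r := undup (s ++ t).
have rs : {subset s <= r} by move=> h; rewrite mem_undup mem_cat => ->.
have rt : {subset t <= r} by move=> h; rewrite mem_undup mem_cat orbC => ->.
have ur : uniq r by exact: undup_uniq.
case: (boolP (g \in r)) => [gr|]; last first.
  by rewrite mem_undup mem_cat negb_or => /andP[/c0-> /d0->].
apply/eqP; rewrite -subr_eq0; apply/eqP.
apply: (homog_indep (c := fun g => c g - d g)) gr => // [h|].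
  by apply: homogD => //; rewrite -scaleN1r; exact: homogZ.
rewrite sumrB -(sum_support us ur rs c0) -(sum_support ut ur rt d0).
by rewrite -vE -vE' subrr.
Qed.

(* The linear map out of V = (+)_g V_g which is [f g] on each V_g. *)
Definition gsum (U : lmodType F) (f : G -> V -> U) v : U :=
  \sum_(g <- gsupp v) f g (gcomp v g).

Lemma gsum_decomposes (U : lmodType F) (f : G -> V -> U) v s c :
  (forall g, linear (f g)) -> decomposes v s c ->
  gsum f v = \sum_(g <- s) f g (c g).
Proof.
move=> hf hd; have cE := decomposes_uniq (gcompP v) hd.
have [us _ s0 _] := gcompP v; have [ut _ t0 _] := hd.
pose r := undup (gsupp v ++ s).
have rs : {subset gsupp v <= r} by move=> h; rewrite mem_undup mem_cat => ->.
have rt : {subset s <= r} by move=> h; rewrite mem_undup mem_cat orbC => ->.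
have ur : uniq r by exact: undup_uniq.
rewrite /gsum (sum_support us ur rs); last by move=> g /s0->; exact: linear0_of.
rewrite (sum_support ut ur rt); last by move=> g /t0->; exact: linear0_of.
by apply: eq_bigr => g _; rewrite cE.
Qed.

Lemma gsum_linear (U : lmodType F) (f : G -> V -> U) :
  (forall g, linear (f g)) -> linear (gsum f).
Proof.
move=> hf a v w.
have [us hc s0 vE] := gcompP v; have [ut hd t0 wE] := gcompP w.
pose r := undup (gsupp v ++ gsupp w).
have rs : {subset gsupp v <= r} by move=> h; rewrite mem_undup mem_cat => ->.
have rt : {subset gsupp w <= r} by move=> h; rewrite mem_undup mem_cat orbC => ->.
have ur : uniq r by exact: undup_uniq.
have hv : decomposes v r (gcomp v).
  split=> //; last by rewrite -(sum_support us ur rs s0).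
  by move=> g gr; apply: s0; apply: contra gr => /rs.
have hw : decomposes w r (gcomp w).
  split=> //; last by rewrite -(sum_support ut ur rt t0).
  by move=> g gr; apply: t0; apply: contra gr => /rt.
rewrite (gsum_decomposes hf hv) (gsum_decomposes hf hw).
rewrite (gsum_decomposes (s := r) (c := fun g => a *: gcomp v g + gcomp w g)) //.
  by rewrite scaler_sumr -big_split; apply: eq_bigr => g _; rewrite hf.
split=> //.
- by move=> g; apply: homogD => //; exact: homogZ.
- move=> g gr; rewrite s0 ?t0 ?scaler0 ?addr0 //.
    by apply: contra gr => /rt.
  by apply: contra gr => /rs.
- case: hv => _ _ _ {1}->; case: hw => _ _ _ {1}->.
  by rewrite scaler_sumr -big_split.
Qed.

Lemma gsum_homog (U : lmodType F) (f : G -> V -> U) g v :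
  (forall g, linear (f g)) -> homog g v -> gsum f v = f g v.
Proof.
move=> hf hv.
rewrite (gsum_decomposes (s := [:: g]) (c := fun h => if h == g then v else 0)) //.
  by rewrite big_seq1 eqxx.
split=> //; last by rewrite big_seq1 eqxx.
  by move=> h; case: eqP => [->|_] //; exact: homog0.
by move=> h; rewrite inE => /negPf->.
Qed.

Lemma graded_ext (U : lmodType F) (f f' : V -> U) : linear f -> linear f' ->
  (forall g v, homog g v -> f v = f' v) -> f =1 f'.
Proof.
move=> hf hf' ff' v; have [_ hc _ ->] := gcompP v.
by rewrite !linear_sum_of //; apply: eq_bigr => g _; apply: ff'.
Qed.

End Components.

Section GradedTensor.
Variables V W : graded_space.

(* v (x) w |-> eps g h *: v (x) w for v in V_g and w in W_h. *)
Definition twist (eps : G -> G -> F) : tens V W -> tens V W :=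
  tens_lift (fun v w =>
    gsum (fun g v' => gsum (fun h w' => eps g h *: pure v' w') w) v).

Lemma twist_bilinear (eps : G -> G -> F) : bilinear_map (fun (v : V) (w : W) =>
  gsum (fun g v' => gsum (fun h w' => eps g h *: pure v' w') w) v).
Proof.
have [pl pr] := @pure_bilinear F V W.
split=> [w|v].
  apply: gsum_linear => g; apply: linear_sumf => h.
  by apply: linear_scaler; exact: pl.
apply: linear_sumf => g; apply: gsum_linear => h.
by apply: linear_scaler; exact: pr.
Qed.

Lemma twist_linear (eps : G -> G -> F) : linear (twist eps).
Proof. exact/tens_lift_linear/twist_bilinear. Qed.

Lemma twist_homog (eps : G -> G -> F) g h (v : V) (w : W) :
  homog g v -> homog h w -> twist eps (pure v w) = eps g h *: pure v w.
Proof.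
move=> hv hw; have [pl pr] := @pure_bilinear F V W.
rewrite /twist tens_liftE; last exact: twist_bilinear.
rewrite (gsum_homog _ hv); last first.
  by move=> x; apply: linear_sumf => y; apply: linear_scaler; exact: pl.
by rewrite (gsum_homog _ hw) // => y; apply: linear_scaler; exact: pr.
Qed.

(* The sum of the subspaces V_x (x) W_y of V (x) W over all x, y with xy = g. *)
Definition tens_homog (g : G) (t : tens V W) : Prop :=
  exists s : seq (V * W),
    (forall p, p \in s -> exists x y, [/\ (x * y)%g = g, homog x p.1 & homog y p.2])
    /\ t = \sum_(p <- s) pure p.1 p.2.

Lemma tens_homog_pure x y (v : V) (w : W) :
  homog x v -> homog y w -> tens_homog (x * y)%g (pure v w).
Proof.
move=> hv hw; exists [:: (v, w)]; rewrite big_seq1; split=> // p.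
by rewrite inE => /eqP->; exists x, y.
Qed.

Fact tens_homog0 g : tens_homog g 0.
Proof. by exists [::]; rewrite big_nil. Qed.

Fact tens_homogD g t u : tens_homog g t -> tens_homog g u -> tens_homog g (t + u).
Proof.
move=> [s [hs ->]] [s' [hs' ->]]; exists (s ++ s'); rewrite big_cat; split=> // p.
by rewrite mem_cat => /orP[/hs|/hs'].
Qed.

Fact tens_homogZ g a t : tens_homog g t -> tens_homog g (a *: t).
Proof.
move=> [s [hs ->]]; exists [seq (a *: p.1, p.2) | p <- s]; split.
  move=> _ /mapP[p /hs[x [y [xy hx hy]]] ->]; exists x, y; split=> //.
  exact: homogZ.
by rewrite scaler_sumr big_map; apply: eq_bigr => p _; rewrite pureZl.
Qed.

Lemma tens_homog_ind (P : tens V W -> Prop) g :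
  P 0 -> (forall t u, P t -> P u -> P (t + u)) ->
  (forall x y v w, (x * y)%g = g -> homog x v -> homog y w -> P (pure v w)) ->
  forall t, tens_homog g t -> P t.
Proof.
move=> P0 PD Pp t [s [hs ->]]; rewrite big_seq; apply: big_ind => // p /hs.
by move=> [x [y [xy hx hy]]]; exact: Pp xy hx hy.
Qed.

Fact tens_homog_span (t : tens V W) : exists s : seq (G * tens V W),
  (forall p, p \in s -> tens_homog p.1 p.2) /\ t = \sum_(p <- s) p.2.
Proof.
have [r ->] := tens_sumP t; elim: r => [|[v w] r [s [hs E]]].
  by exists [::]; rewrite !big_nil.
have [_ hv _ vE] := gcompP v; have [_ hw _ wE] := gcompP w.
have [pl pr] := @pure_bilinear F V W.
exists ([seq ((x * y)%g, pure (gcomp v x) (gcomp w y))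
        | x <- gsupp v, y <- gsupp w] ++ s).
split=> [p|].
  rewrite mem_cat => /orP[/allpairsP[[x y] [_ _ ->]]|/hs] //.
  exact: tens_homog_pure.
rewrite big_cons big_cat -E big_allpairs_dep /=; congr (_ + _).
rewrite {1}vE (linear_sum_of (pl w)); apply: eq_bigr => x _.
by rewrite {1}wE (linear_sum_of (pr _)).
Qed.

Fact tens_homog_indep (s : seq G) (c : G -> tens V W) : uniq s ->
  (forall g, tens_homog g (c g)) -> \sum_(g <- s) c g = 0 ->
  forall g, g \in s -> c g = 0.
Proof.
move=> us hc c0 g gs; pose P := twist (fun x y => ((x * y)%g == g)%:R).
have P_lin : linear P by exact: twist_linear.
have PE h t : tens_homog h t -> P t = (h == g)%:R *: t.
  move: t; apply: tens_homog_ind.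
  - by rewrite scaler0 (linear0_of P_lin).
  - by move=> t u; rewrite scalerDr (linearD_of P_lin) => -> ->.
  - by move=> x y v w <- hx hy; rewrite /P (twist_homog _ hx hy).
have := linear_sum_of P_lin s c.
rewrite c0 (linear0_of P_lin) (bigD1_seq g) //=.
rewrite (PE g) // eqxx scale1r big1 ?addr0 // => h hg.
by rewrite (PE h) // (negPf hg) scale0r.
Qed.

Definition graded_tens : graded_space :=
  GradedSpace tens_homog0 tens_homogD tens_homogZ tens_homog_span tens_homog_indep.

Fact twist_deg (eps : G -> G -> F) g (t : graded_tens) :
  homog g t -> homog g (twist eps t : graded_tens).
Proof.
move: t; apply: tens_homog_ind.
- by rewrite (linear0_of (twist_linear _)); exact: tens_homog0.
- by move=> t u; rewrite (linearD_of (twist_linear _)); exact: tens_homogD.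
- move=> x y v w <- hx hy; rewrite (twist_homog _ hx hy).
  exact/tens_homogZ/tens_homog_pure.
Qed.

Definition graded_twist (eps : G -> G -> F) : graded_hom graded_tens graded_tens :=
  @GradedHom graded_tens graded_tens (twist eps) (twist_linear eps) (twist_deg eps).

End GradedTensor.

Section GradedMonoidal.
Implicit Types V W U T : graded_space.

Fact tens_map_deg V V' W W' (f : graded_hom V V') (g : graded_hom W W') x
    (t : graded_tens V W) :
  homog x t -> homog x (tens_map f g t : graded_tens V' W').
Proof.
have hl := tens_map_linear (ghom_linear f) (ghom_linear g).
move: t; apply: tens_homog_ind.
- by rewrite (linear0_of hl); exact: homog0.
- by move=> t u; rewrite (linearD_of hl); exact: homogD.
- move=> y z v w <- hy hz; rewrite (tens_mapE _ _ (ghom_linear f) (ghom_linear g)).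
  by apply: tens_homog_pure; exact: ghom_homog.
Qed.

Definition graded_tensh V V' W W' (f : graded_hom V V') (g : graded_hom W W') :
    graded_hom (graded_tens V W) (graded_tens V' W') :=
  @GradedHom (graded_tens V W) (graded_tens V' W') (tens_map f g)
    (tens_map_linear (ghom_linear f) (ghom_linear g)) (@tens_map_deg _ _ _ _ f g).

Lemma graded_tenshE V V' W W' (f : graded_hom V V') (g : graded_hom W W') v w :
  graded_tensh f g (pure v w) = pure (f v) (g w).
Proof. exact: tens_mapE (ghom_linear f) (ghom_linear g). Qed.

Section Line.
Variable x : G.

(* F in degree x, and 0 in the other degrees. *)
Definition line_homog (g : G) (k : F^o) : Prop := g = x \/ k = 0.

Fact line_homog0 g : line_homog g 0. Proof. by right. Qed.

Fact line_homogD g k l : line_homog g k -> line_homog g l -> line_homog g (k + l).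
Proof. by case=> [->|->]; [left | rewrite add0r]. Qed.

Fact line_homogZ g a k : line_homog g k -> line_homog g (a *: k).
Proof. by case=> [->|->]; [left | right; rewrite scaler0]. Qed.

Fact line_homog_span (k : F^o) : exists s : seq (G * F^o),
  (forall p, p \in s -> line_homog p.1 p.2) /\ k = \sum_(p <- s) p.2.
Proof.
exists [:: (x, k)]; rewrite big_seq1; split=> // p.
by rewrite inE => /eqP->; left.
Qed.

Fact line_homog_indep (s : seq G) (c : G -> F^o) : uniq s ->
  (forall g, line_homog g (c g)) -> \sum_(g <- s) c g = 0 ->
  forall g, g \in s -> c g = 0.
Proof.
move=> us hc c0 g gs; have [gx|//] := hc g.
rewrite -c0 (bigD1_seq g) //= big1 ?addr0 // => h hg.
by have [hx|//] := hc h; rewrite hx gx eqxx in hg.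
Qed.

Definition graded_line : graded_space :=
  GradedSpace line_homog0 line_homogD line_homogZ line_homog_span line_homog_indep.

End Line.

Definition graded_unit : graded_space := graded_line 1%g.

Fact tens_assoc_deg V W U g (t : graded_tens (graded_tens V W) U) :
  homog g t -> homog g (tens_assoc t : graded_tens V (graded_tens W U)).
Proof.
have hl := @tens_assoc_linear F V W U.
move: t; apply: tens_homog_ind.
- by rewrite (linear0_of hl); exact: homog0.
- by move=> t u; rewrite (linearD_of hl); exact: homogD.
move=> x y t u xy ht hu; move: t ht.
apply: (@tens_homog_ind _ _ (fun t => homog g
  (tens_assoc (pure t u) : graded_tens V (graded_tens W U)))).
- by rewrite pure0l (linear0_of hl); exact: homog0.
- by move=> t t'; rewrite pureDl (linearD_of hl); exact: homogD.
- move=> x1 x2 v w x12 hv hw; rewrite tens_assocE -xy -x12 -mulgA.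
  by do 2!apply: tens_homog_pure => //.
Qed.

Fact tens_assoc_inv_deg V W U g (t : graded_tens V (graded_tens W U)) :
  homog g t -> homog g (tens_assoc_inv t : graded_tens (graded_tens V W) U).
Proof.
have hl := @tens_assoc_inv_linear F V W U.
move: t; apply: tens_homog_ind.
- by rewrite (linear0_of hl); exact: homog0.
- by move=> t u; rewrite (linearD_of hl); exact: homogD.
move=> x y v t xy hv ht; move: t ht.
apply: (@tens_homog_ind _ _ (fun t => homog g
  (tens_assoc_inv (pure v t) : graded_tens (graded_tens V W) U))).
- by rewrite (linear0_of ((@pure_bilinear F _ _).2 v)) (linear0_of hl); exact: homog0.
- by move=> t t'; rewrite pureDr (linearD_of hl); exact: homogD.
- move=> y1 y2 w u y12 hw hu; rewrite tens_assoc_invE -xy -y12 mulgA.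
  by do 2!apply: tens_homog_pure => //.
Qed.

Definition graded_assoc V W U :
    graded_hom (graded_tens (graded_tens V W) U) (graded_tens V (graded_tens W U)) :=
  @GradedHom (graded_tens (graded_tens V W) U) (graded_tens V (graded_tens W U))
    (@tens_assoc F V W U) (@tens_assoc_linear F V W U) (@tens_assoc_deg V W U).

Definition graded_assoc_inv V W U :
    graded_hom (graded_tens V (graded_tens W U)) (graded_tens (graded_tens V W) U) :=
  @GradedHom (graded_tens V (graded_tens W U)) (graded_tens (graded_tens V W) U)
    (@tens_assoc_inv F V W U) (@tens_assoc_inv_linear F V W U)
    (@tens_assoc_inv_deg V W U).

Fact tens_lunit_deg V g (t : graded_tens graded_unit V) :
  homog g t -> homog g (tens_lunit t : V).
Proof.
have hl := @tens_lunit_linear F V.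
move: t; apply: (@tens_homog_ind graded_unit V (fun t => homog g (tens_lunit t : V))).
- by rewrite (linear0_of hl); exact: homog0.
- by move=> t u; rewrite (linearD_of hl); exact: homogD.
move=> x y k v <- hk hv; rewrite tens_lunitE.
case: hk => ->; first by rewrite mul1g; exact: homogZ.
by rewrite scale0r; exact: homog0.
Qed.

Fact tens_runit_deg V g (t : graded_tens V graded_unit) :
  homog g t -> homog g (tens_runit t : V).
Proof.
have hl := @tens_runit_linear F V.
move: t; apply: (@tens_homog_ind V graded_unit (fun t => homog g (tens_runit t : V))).
- by rewrite (linear0_of hl); exact: homog0.
- by move=> t u; rewrite (linearD_of hl); exact: homogD.
move=> x y v k <- hv hk; rewrite tens_runitE.
case: hk => ->; first by rewrite mulg1; exact: homogZ.
by rewrite scale0r; exact: homog0.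
Qed.

Definition graded_lunit V : graded_hom (graded_tens graded_unit V) V :=
  @GradedHom (graded_tens graded_unit V) V (@tens_lunit F V)
    (@tens_lunit_linear F V) (@tens_lunit_deg V).

Definition graded_runit V : graded_hom (graded_tens V graded_unit) V :=
  @GradedHom (graded_tens V graded_unit) V (@tens_runit F V)
    (@tens_runit_linear F V) (@tens_runit_deg V).

Fact graded_lunit_inv_deg V g (v : V) :
  homog g v -> homog g (pure (1 : graded_unit) v : graded_tens graded_unit V).
Proof.
by move=> hv; rewrite -[g]mul1g; apply: (@tens_homog_pure graded_unit) => //; left.
Qed.

Fact graded_runit_inv_deg V g (v : V) :
  homog g v -> homog g (pure v (1 : graded_unit) : graded_tens V graded_unit).
Proof.
by move=> hv; rewrite -[g]mulg1; apply: (@tens_homog_pure _ graded_unit) => //; left.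
Qed.

Definition graded_lunit_inv V : graded_hom V (graded_tens graded_unit V) :=
  @GradedHom V (graded_tens graded_unit V) (pure (1 : graded_unit))
    ((@pure_bilinear F graded_unit V).2 _) (@graded_lunit_inv_deg V).

Definition graded_runit_inv V : graded_hom V (graded_tens V graded_unit) :=
  @GradedHom V (graded_tens V graded_unit) ((@pure F V graded_unit)^~ 1)
    ((@pure_bilinear F V graded_unit).1 _) (@graded_runit_inv_deg V).

Lemma graded_tens_ext V W U (f g : graded_hom (graded_tens V W) U) :
  (forall v w, f (pure v w) = g (pure v w)) -> f = g.
Proof.
move=> fg; apply: graded_hom_eq.
exact: (tens_ext (ghom_linear f) (ghom_linear g) fg).
Qed.

Lemma graded_tens_ext3l V W U T
    (f g : graded_hom (graded_tens (graded_tens V W) U) T) :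
  (forall v w u, f (pure (pure v w) u) = g (pure (pure v w) u)) -> f = g.
Proof.
move=> fg; apply: graded_hom_eq.
exact: (tens_ext3l (ghom_linear f) (ghom_linear g) fg).
Qed.

Lemma graded_tens_ext3r V W U T
    (f g : graded_hom (graded_tens V (graded_tens W U)) T) :
  (forall v w u, f (pure v (pure w u)) = g (pure v (pure w u))) -> f = g.
Proof.
move=> fg; apply: graded_hom_eq.
exact: (tens_ext3r (ghom_linear f) (ghom_linear g) fg).
Qed.

Lemma graded_tens_ext4 V W U T X
    (f g : graded_hom (graded_tens (graded_tens (graded_tens V W) U) T) X) :
  (forall v w u t, f (pure (pure (pure v w) u) t) = g (pure (pure (pure v w) u) t)) ->
  f = g.
Proof.
move=> fg; apply: graded_hom_eq.
exact: (tens_ext4 (ghom_linear f) (ghom_linear g) fg).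
Qed.

Lemma graded_tens_homog_ext V W U (f f' : graded_hom (graded_tens V W) U) :
  (forall x y v w, homog x v -> homog y w -> f (pure v w) = f' (pure v w)) -> f = f'.
Proof.
move=> ff'; apply: graded_tens_ext => v w; move: v.
apply: (graded_ext (linear_comp (ghom_linear f) ((@pure_bilinear F V W).1 w))
  (linear_comp (ghom_linear f') ((@pure_bilinear F V W).1 w))) => x v hv /=.
move: w; apply: (graded_ext (linear_comp (ghom_linear f) ((@pure_bilinear F V W).2 v))
  (linear_comp (ghom_linear f') ((@pure_bilinear F V W).2 v))) => y w hw /=.
exact: ff' hv hw.
Qed.

Lemma graded_tens_homog_ext3 V W U T
    (f f' : graded_hom (graded_tens (graded_tens V W) U) T) :
  (forall x y z v w u, homog x v -> homog y w -> homog z u ->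
    f (pure (pure v w) u) = f' (pure (pure v w) u)) -> f = f'.
Proof.
move=> ff'; apply: graded_tens_ext3l => v w u; move: u.
have [_ pr] := @pure_bilinear F (graded_tens V W) U.
apply: (graded_ext (linear_comp (ghom_linear f) (pr (pure v w)))
  (linear_comp (ghom_linear f') (pr (pure v w)))) => z u hu /=.
have [pl _] := @pure_bilinear F (graded_tens V W) U.
have [ql qr] := @pure_bilinear F V W.
move: v; apply: (graded_ext (linear_comp (linear_comp (ghom_linear f) (pl u)) (ql w))
  (linear_comp (linear_comp (ghom_linear f') (pl u)) (ql w))) => x v hv /=.
move: w; apply: (graded_ext (linear_comp (linear_comp (ghom_linear f) (pl u)) (qr v))
  (linear_comp (linear_comp (ghom_linear f') (pl u)) (qr v))) => y w hw /=.
exact: ff' hv hw hu.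
Qed.

Fact graded_tensh_id V W :
  graded_tensh (graded_id V) (graded_id W) = graded_id (graded_tens V W).
Proof.
apply: graded_tens_ext => v w.
exact: graded_tenshE.
Qed.

Fact graded_tensh_comp V V' V'' W W' W'' (f' : graded_hom V' V'') (f : graded_hom V V')
    (g' : graded_hom W' W'') (g : graded_hom W W') :
  graded_tensh (graded_comp f' f) (graded_comp g' g) =
  graded_comp (graded_tensh f' g') (graded_tensh f g).
Proof.
apply: graded_tens_ext => v w.
change (graded_tensh (graded_comp f' f) (graded_comp g' g) (pure v w) =
  graded_tensh f' g' (graded_tensh f g (pure v w))).
by rewrite !graded_tenshE.
Qed.

Fact graded_assoc_nat V V' W W' U U' (f : graded_hom V V') (g : graded_hom W W')
    (h : graded_hom U U') :
  graded_comp (graded_assoc V' W' U') (graded_tensh (graded_tensh f g) h) =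
  graded_comp (graded_tensh f (graded_tensh g h)) (graded_assoc V W U).
Proof.
apply: graded_tens_ext3l => v w u.
change (graded_assoc V' W' U' (graded_tensh (graded_tensh f g) h (pure (pure v w) u)) =
  graded_tensh f (graded_tensh g h) (tens_assoc (pure (pure v w) u))).
by rewrite tens_assocE !graded_tenshE /= tens_assocE.
Qed.

Fact graded_lunit_nat V V' (f : graded_hom V V') :
  graded_comp (graded_lunit V') (graded_tensh (graded_id graded_unit) f) =
  graded_comp f (graded_lunit V).
Proof.
apply: graded_tens_ext => k v.
change (graded_lunit V' (graded_tensh (graded_id graded_unit) f (pure k v)) =
  f (tens_lunit (pure k v))).
by rewrite graded_tenshE /= !tens_lunitE (linearZ_of (ghom_linear f)).
Qed.

Fact graded_runit_nat V V' (f : graded_hom V V') :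
  graded_comp (graded_runit V') (graded_tensh f (graded_id graded_unit)) =
  graded_comp f (graded_runit V).
Proof.
apply: graded_tens_ext => v k.
change (graded_runit V' (graded_tensh f (graded_id graded_unit) (pure v k)) =
  f (tens_runit (pure v k))).
by rewrite graded_tenshE /= !tens_runitE (linearZ_of (ghom_linear f)).
Qed.

Fact graded_assoc_iso V W U : @is_iso (VecG_category) _ _ (graded_assoc V W U).
Proof.
exists (graded_assoc_inv V W U); split.
  apply: graded_tens_ext3l => v w u.
  by rewrite /= tens_assocE tens_assoc_invE.
apply: graded_tens_ext3r => v w u.
by rewrite /= tens_assoc_invE tens_assocE.
Qed.

Fact graded_lunit_iso V : @is_iso VecG_category _ _ (graded_lunit V).
Proof.
exists (graded_lunit_inv V); split; last first.
  by apply: graded_hom_eq => v; rewrite /= tens_lunitE scale1r.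
apply: graded_tens_ext => k v.
by rewrite /= tens_lunitE pureZr -pureZl; congr pure; exact: mulr1.
Qed.

Fact graded_runit_iso V : @is_iso VecG_category _ _ (graded_runit V).
Proof.
exists (graded_runit_inv V); split; last first.
  by apply: graded_hom_eq => v; rewrite /= tens_runitE scale1r.
apply: graded_tens_ext => v k.
by rewrite /= tens_runitE pureZl -pureZr; congr pure; exact: mulr1.
Qed.

Fact graded_pentagon V W U T :
  graded_comp (graded_assoc V W (graded_tens U T)) (graded_assoc (graded_tens V W) U T) =
  graded_comp
    (graded_comp (graded_tensh (graded_id V) (graded_assoc W U T))
       (graded_assoc V (graded_tens W U) T))
    (graded_tensh (graded_assoc V W U) (graded_id T)).
Proof.
apply: graded_tens_ext4 => v w u t.
change (tens_assoc (tens_assoc (pure (pure (pure v w) u) t)) =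
  graded_tensh (graded_id V) (graded_assoc W U T) (tens_assoc
    (graded_tensh (graded_assoc V W U) (graded_id T) (pure (pure (pure v w) u) t)))).
rewrite graded_tenshE [graded_assoc V W U _]tens_assocE !tens_assocE graded_tenshE.
by rewrite [graded_assoc W U T _]tens_assocE.
Qed.

Fact graded_triangle V W :
  graded_comp (graded_tensh (graded_id V) (graded_lunit W))
    (graded_assoc V graded_unit W) =
  graded_tensh (graded_runit V) (graded_id W).
Proof.
apply: graded_tens_ext3l => v k w.
change (graded_tensh (graded_id V) (graded_lunit W) (tens_assoc (pure (pure v k) w)) =
  graded_tensh (graded_runit V) (graded_id W) (pure (pure v k) w)).
by rewrite tens_assocE !graded_tenshE /= tens_lunitE tens_runitE pureZl pureZr.
Qed.

Definition VecG : monoidal_category :=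
  @MonoidalCategory VecG_category graded_tens graded_tensh graded_unit
    graded_assoc graded_lunit graded_runit graded_tensh_id graded_tensh_comp
    graded_assoc_nat graded_lunit_nat graded_runit_nat
    graded_assoc_iso graded_lunit_iso graded_runit_iso
    graded_pentagon graded_triangle.

Definition contraction_triple (eps : G -> G -> F) : monoidal_triple VecG VecG :=
  @MonoidalTriple VecG VecG (id_functor VecG)
    (fun V W => graded_twist V W eps) (graded_id graded_unit).

End GradedMonoidal.

Definition generic_contraction (eps : G -> G -> F) : Prop :=
  (forall g h, eps g h = eps h g) /\
  (forall g h k, eps g (h * k)%g * eps h k = eps k (g * h)%g * eps g h).

(* The unit axioms do not follow from [generic_contraction]. *)
Lemma contraction_triple_laxP (eps : G -> G -> F) : generic_contraction eps ->
  is_lax_monoidal (contraction_triple eps) <-> forall g, eps 1%g g = 1.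
Proof.
case=> eps_sym eps_cocycle; split=> [[_ _ unitl _] g|eps1].
  have h1 : homog 1%g (1 : graded_unit) by left.
  have hg : homog g (1 : graded_line g) by left.
  have := congr1 (fun f : graded_hom (graded_tens graded_unit (graded_line g))
    (graded_line g) => f (pure (1 : graded_unit) (1 : graded_line g)))
    (unitl (graded_line g)).
  rewrite /= (tens_mapE _ _ (@linear_id F _) (@linear_id F _)) (twist_homog _ h1 hg).
  rewrite (linearZ_of (@tens_lunit_linear F _)) tens_lunitE scale1r.
  by move=> <-; rewrite /GRing.scale /= mulr1.
split=> [V V' W W' f f'|V W U|V|V].
- apply: graded_tens_homog_ext => x y v w hx hy.
  change (twist eps (graded_tensh f f' (pure v w)) =
    graded_tensh f f' (twist eps (pure v w))).
  rewrite (twist_homog _ hx hy) (linearZ_of (ghom_linear _)) !graded_tenshE.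
  by apply: twist_homog; exact: ghom_homog.
- apply: graded_tens_homog_ext3 => x y z v w u hx hy hz.
  change (tens_assoc (twist eps (graded_tensh (graded_twist V W eps) (graded_id U)
    (pure (pure v w) u) : graded_tens (graded_tens V W) U)) =
    twist eps (graded_tensh (graded_id V) (graded_twist W U eps)
      (tens_assoc (pure (pure v w) u)) : graded_tens V (graded_tens W U))).
  have hxy : homog (x * y)%g (pure v w : graded_tens V W) by exact: tens_homog_pure.
  have hyz : homog (y * z)%g (pure w u : graded_tens W U) by exact: tens_homog_pure.
  rewrite tens_assocE !graded_tenshE /= (twist_homog _ hx hy) (twist_homog _ hy hz).
  rewrite pureZl pureZr !(linearZ_of (twist_linear _)).
  rewrite (twist_homog _ hxy hz) (twist_homog _ hx hyz).
  rewrite !(linearZ_of (@tens_assoc_linear F _ _ _)) tens_assocE !scalerA.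
  by rewrite mulrC (eps_sym (x * y)%g) -eps_cocycle mulrC.
- apply: graded_tens_homog_ext => x y k v hx hy.
  rewrite /= (tens_mapE _ _ (@linear_id F _) (@linear_id F _)) (twist_homog _ hx hy).
  rewrite (linearZ_of (@tens_lunit_linear F _)) tens_lunitE.
  by case: hx => [->|->]; rewrite ?eps1 ?scale1r // scale0r scaler0.
- apply: graded_tens_homog_ext => x y v k hx hy.
  rewrite /= (tens_mapE _ _ (@linear_id F _) (@linear_id F _)) (twist_homog _ hx hy).
  rewrite (linearZ_of (@tens_runit_linear F _)) tens_runitE eps_sym.
  by case: hy => [->|->]; rewrite ?eps1 ?scale1r // scale0r scaler0.
Qed.

Definition coboundary (alpha : G -> F) (g h : G) : F :=
  alpha g * alpha h / alpha (g * h)%g.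

Definition equivalent_via_normalization (eps eps' : G -> G -> F) : Prop :=
  exists alpha : G -> F, (forall g, alpha g != 0) /\
    forall g h, eps' g h = eps g h * coboundary alpha g h.

End GradedSpaces.

(* Main.v *)
(* A monoidal natural automorphism of the underlying functors acts on the line
   in degree g by a scalar lam g, and hence, by naturality along the maps from
   this line sending 1 to a vector v of degree g, on all of V_g.  Compatibility
   with J on 1 (x) 1 in degrees g and h reads
   lam (g h) eps(g, h) = eps'(g, h) lam g lam h, that is, eps' = eps d(lam^-1). *)
Require Import Defs.
From mathcomp Require Import all_boot all_algebra.

Set Implicit Arguments.
Unset Strict Implicit.
Unset Printing Implicit Defensive.

Import GRing.Theory.
Local Open Scope ring_scope.

Section GradedScaling.
Variables (G : groupType) (F : fieldType).
Implicit Types V W : graded_space G F.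

Fact line_map_linear V (v : V) : linear (fun k : F^o => (k : F) *: v).
Proof. by move=> a k l; rewrite scalerDl scalerA. Qed.

Fact line_map_deg g V (v : V) : homog g v ->
  forall x (k : graded_line F g), homog x k -> homog x ((k : F) *: v).
Proof.
move=> hv x k [->|->]; first exact: homogZ.
by rewrite scale0r; exact: homog0.
Qed.

Definition line_map g V (v : V) (hv : homog g v) : graded_hom (graded_line F g) V :=
  @GradedHom G F (graded_line F g) V _ (line_map_linear v) (line_map_deg hv).

(** Evaluate the naturality square of [line_map hv] at 1: one side is [nu V (1 *: v)], the other is
    [v] scaled by the value of [nu] at 1. *)
Lemma nat_homogE (nu : forall V, graded_hom V V) :
    (forall V W (f : graded_hom V W), nu W \o f =1 f \o nu V) ->
  forall g V (v : V), homog g v -> nu V v = (nu (graded_line F g) (1 : F^o) : F) *: v.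
Proof.
move=> nu_nat g V v hv.
by have /= := nu_nat _ _ (line_map hv) 1; rewrite scale1r.
Qed.

(** The left unit constraint sends this tensor to 1. It allows two scalar multiples of 1 (x) 1 to be
    compared by their coefficients. *)
Lemma pure11_neq0 : pure (1 : F^o) (1 : F^o) <> 0.
Proof.
move=> /(congr1 (@tens_lunit F F^o)).
rewrite (linear0_of (@tens_lunit_linear F F^o)) tens_lunitE scale1r.
exact/eqP/oner_neq0.
Qed.

Variable lam : G -> F.

(** Candidate component at [V] of the isomorphism in the converse direction. *)
Definition gscale V : V -> V := gsum (fun g v => lam g *: v).

Lemma gscale_linear V : linear (@gscale V).
Proof. by apply: gsum_linear => g; apply: linear_scaler; exact: linear_id. Qed.

Lemma gscale_homog V g (v : V) : homog g v -> gscale v = lam g *: v.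
Proof.
move=> hv; rewrite /gscale (gsum_homog _ hv) // => h.
by apply: linear_scaler; exact: linear_id.
Qed.

Fact gscale_deg V g (v : V) : homog g v -> homog g (gscale v).
Proof. by move=> hv; rewrite (gscale_homog hv); exact: homogZ. Qed.

Definition graded_scale V : graded_hom V V :=
  GradedHom (@gscale_linear V) (@gscale_deg V).

Lemma graded_scale_nat V W (f : graded_hom V W) :
  graded_comp (graded_scale W) f = graded_comp f (graded_scale V).
Proof.
apply: graded_hom_eq; apply: graded_ext => [||g v hv]; try exact: ghom_linear.
rewrite /= (gscale_homog hv) (gscale_homog (ghom_homog f hv)).
by rewrite (linearZ_of (ghom_linear f)).
Qed.

(** By linearity it suffices to test v (x) w with v, w homogeneous of degrees g, h. This tensor has
    degree gh, so the two composites multiply it by the two sides of the hypothesis. *)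
Lemma graded_scale_tens (eps eps' : G -> G -> F) V W :
    (forall g h, lam (g * h)%g * eps g h = eps' g h * (lam g * lam h)) ->
  graded_comp (graded_scale (graded_tens V W)) (graded_twist V W eps) =
  graded_comp (graded_twist V W eps') (graded_tensh (graded_scale V) (graded_scale W)).
Proof.
move=> lamE; apply: graded_tens_homog_ext => g h v w hv hw.
change (gscale (twist eps (pure v w) : graded_tens V W) =
  twist eps' (graded_tensh (graded_scale V) (graded_scale W) (pure v w))).
rewrite graded_tenshE /= (gscale_homog hv) (gscale_homog hw) pureZl pureZr.
rewrite !(linearZ_of (twist_linear _)) (twist_homog _ hv hw) (twist_homog _ hv hw).
rewrite (linearZ_of (@gscale_linear _)).
rewrite (@gscale_homog (graded_tens V W) (g * h)%g); last exact: tens_homog_pure.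
by rewrite !scalerA mulrC lamE mulrC.
Qed.

End GradedScaling.

Lemma graded_scaleK (G : groupType) (F : fieldType) (lam mu : G -> F)
    (V : graded_space G F) : (forall g, mu g * lam g = 1) ->
  graded_comp (graded_scale mu V) (graded_scale lam V) = graded_id V.
Proof.
move=> lamK; apply: graded_hom_eq; apply: graded_ext => [||g v hv]; try exact: ghom_linear.
rewrite /= (gscale_homog _ hv) (linearZ_of (@gscale_linear _ _ mu V)).
by rewrite (gscale_homog _ hv) scalerA mulrC lamK scale1r.
Qed.

Theorem proposition36 (G : groupType) (mulG_comm : forall g h : G, (g * h)%g = (h * g)%g)
    (F : fieldType) (eps eps' : G -> G -> F)
    (eps_contraction : generic_contraction eps)
    (eps'_contraction : generic_contraction eps')
    (eps_lax : is_lax_monoidal (contraction_triple eps))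
    (eps'_lax : is_lax_monoidal (contraction_triple eps')) :
  monoidally_isomorphic (contraction_triple eps) (contraction_triple eps') <->
  equivalent_via_normalization eps eps'.
Proof.
split=> [[nu [[nu_nat nu_mul _] nu_iso]]|[alpha [alpha0 epsE]]].
  pose lam g : F := (nu (graded_line F g) : graded_hom _ _) (1 : F^o).
  have nuE g (V : graded_space G F) (v : V) :
      homog g v -> (nu V : graded_hom _ _) v = lam g *: v.
    apply: (@nat_homogE G F nu) => U W f x.
    exact: (congr1 (fun k : graded_hom U W => k x) (nu_nat U W f)).
  have hline (g : G) : homog g (1 : graded_line F g) by left.
  have lam0 g : lam g != 0.
    (* If [lam g] were 0, then [nu] would kill 1, and so would its composite with the inverse [mu],
       which is the identity. *)
    have [mu [muK _]] := nu_iso (graded_line F g).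
    apply/eqP => lamg0; have /eqP := oner_neq0 F; apply.
    have := congr1 (fun k : graded_hom _ _ => k (1 : graded_line F g)) muK.
    rewrite /= -/(lam g) lamg0 => <-.
    exact: (linear0_of (ghom_linear (mu : graded_hom _ _))).
  exists (fun g => (lam g)^-1); split=> [g|g h]; first by rewrite invr_eq0.
  set V := graded_line F g; set W := graded_line F h.
  have hp : homog (g * h)%g (pure (1 : V) (1 : W) : graded_tens V W).
    exact: (tens_homog_pure (hline g) (hline h)).
  have := congr1 (fun k : graded_hom (graded_tens V W) (graded_tens V W) =>
    k (pure (1 : V) (1 : W))) (nu_mul V W).
  change ((nu (graded_tens V W) : graded_hom _ _) (twist eps (pure (1 : V) (1 : W))) =
    twist eps' (graded_tensh (nu V) (nu W) (pure (1 : V) (1 : W))) -> eps' g h =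
    eps g h * coboundary (fun g => (lam g)^-1) g h).
  rewrite graded_tenshE (nuE _ _ _ (hline g)) (nuE _ _ _ (hline h)) pureZl pureZr.
  rewrite !(linearZ_of (twist_linear _)) !(twist_homog _ (hline g) (hline h)).
  rewrite (linearZ_of (ghom_linear _)) (nuE _ _ _ hp) !scalerA => /eqP.
  rewrite -subr_eq0 -scalerBl => /eqP E.
  (* [c] is the difference of the coefficients of 1 (x) 1 on the two sides; were it invertible, 1
     (x) 1 would vanish. *)
  set c := (X in X *: _ = 0) in E.
  have /eqP : c = 0.
    apply/eqP; apply/negPn/negP => c0; apply: (@pure11_neq0 F).
    have := congr1 (fun t => c^-1 *: t) E.
    by rewrite /= scaler0 scalerA mulVf // scale1r.
  rewrite subr_eq0 => /eqP E'.
  by rewrite /coboundary invrK mulrCA E' -invfM mulKf // mulf_neq0.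
(* The inverse is forced by the direction of the isomorphism: [lam (g * h) * eps g h = eps' g h *
   (lam g * lam h)] has to follow from [epsE]. *)
pose lam g := (alpha g)^-1.
have lamK g : alpha g * lam g = 1 by rewrite mulfV.
have alphaK g : lam g * alpha g = 1 by rewrite mulVf.
exists (graded_scale lam); split=> [|V].
  split.
  - exact: graded_scale_nat.
  - move=> V W; apply: graded_scale_tens => g h.
    rewrite epsE /coboundary /lam -invfM [eps g h * _]mulrA mulrAC mulfK ?mulf_neq0 //.
    exact: mulrC.
  (* The unit condition needs [lam 1 = 1]. Unitality of both functors gives
     [eps 1 1 = eps' 1 1 = 1], while [coboundary alpha 1 1] equals [alpha 1]. *)
  - have alpha1 : alpha 1%g = 1.
      have := epsE 1%g 1%g.
      rewrite ((contraction_triple_laxP eps_contraction).1 eps_lax).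
      rewrite ((contraction_triple_laxP eps'_contraction).1 eps'_lax).
      by rewrite /coboundary mulg1 mulfK // mul1r.
    apply: graded_hom_eq; apply: graded_ext => [||g k hk]; try exact: ghom_linear.
    change (gscale lam (k : graded_unit G F) = k).
    rewrite (gscale_homog _ hk).
    by case: hk => ->; rewrite ?scaler0 // /lam alpha1 invr1 scale1r.
exists (graded_scale alpha V); split; exact: graded_scaleK.
Qed.
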